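(* Let $\mathcal{G}$ be a closed subgroup of $\mathcal{O}(d)$ and suppose there is a constant $\beta\in(0,1]$ such that $$\beta\,\mathrm{Tr}\left(I_d-X^\top\Pi(X)\right)\le d-\|X\|_F^2\quad\text{for all }X\in\mathrm{conv}(\mathcal{G}).$$ Let $\eta>0$ and $\epsilon\ge0$ be given parameters. Then the entropic spectral estimator $\widehat G$ (with input the matrix $C$ and a finite set $\mathcal{Q}\subseteq\mathcal{O}(d)/\mathcal{G}$ satisfying $\min_{[Q]\in\mathcal{Q}}\mathrm{dist}([Q],[Q^*])\le\epsilon$) satisfies $$\varepsilon(\widehat G)\le2\sqrt{\frac{2n}{\beta}}\,\epsilon+\frac{12\sqrt d}{\beta\eta\sqrt n}\,\|C-\eta\cdot G^*{G^*}^\top\|.$$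
   Context: $\mathcal{O}(d)$ is the group of $d\times d$ real orthogonal matrices; $\|\cdot\|$, $\|\cdot\|_F$ are the operator and Frobenius norms; $\mathrm{conv}$ is the Euclidean convex hull in $\mathbb{R}^{d\times d}$. $\mathcal{G}^n\subset\mathbb{R}^{nd\times d}$ is the set of $G$ whose $n$ consecutive $d\times d$ blocks $[G]_i$ lie in $\mathcal{G}$; $G^*\in\mathcal{G}^n$ is the ground truth. $\Pi(X)\in\operatorname{argmin}_{Q\in\mathcal{G}}\|X-Q\|_F$ for $X\in\mathbb{R}^{d\times d}$ (any choice of minimizer), and $[\Pi^n(Y)]_i=\Pi([Y]_i)$ for $Y\in\mathbb{R}^{nd\times d}$. Estimation error: $\varepsilon(G)=\min_{Q\in\mathcal{G}}\|G-G^*Q\|_F$. The symmetric matrix $C\in\mathbb{R}^{nd\times nd}$ is built from observations $C_{ij}\in\mathbb{R}^{d\times d}$, $(i,j)\in E\subseteq\{(i,j)\in[n]^2:i<j\}$: $[C]_{ij}=C_{ij}$ if $(i,j)\in E$, $C_{ji}^\top$ if $(j,i)\in E$, $I_d$ if $i=j$, $\mathbf0$ otherwise. $V_C\in\mathbb{R}^{nd\times d}$ is a matrix whose columns are orthonormal eigenvectors of $C$ associated with its $d$ largest eigenvalues. $Q^*\in\mathcal{O}(d)$ denotes an orthogonal matrix with $$\left\|V_CQ^*-\tfrac1{\sqrt n}G^*\right\|_F\le\frac{2\sqrt{2d}\,\|C-\eta\cdot G^*{G^*}^\top\|}{\eta n}$$ (such a $Q^*$ exists by a variant of the Davis–Kahan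 theorem). $\mathcal{O}(d)/\mathcal{G}$ is the set of left cosets $[Q]=\{QQ':Q'\in\mathcal{G}\}$, with distance $\mathrm{dist}([Q_1],[Q_2])=\min_{Q'\in\mathcal{G}}\|Q_1-Q_2Q'\|_F$. Entropic spectral estimator: given $C$ and a finite set $\mathcal{Q}$ as in the claim, let $[\widehat Q]$ be a maximizer over $[Q]\in\mathcal{Q}$ of $\psi([Q])=\langle C\,\Pi^n(V_CQ),\Pi^n(V_CQ)\rangle$, where $\langle X,Y\rangle=\mathrm{Tr}(X^\top Y)$ (since $\Pi^n(V_CQQ')=\Pi^n(V_CQ)Q'$ for $Q'\in\mathcal{G}$, $\psi$ does not depend on the representative; where projections are not unique a fixed choice compatible with this is made). The output is $\widehat G=\Pi^n(V_C\widehat Q)$. *)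

(* Defs.v *)
From HB Require Import structures.
From mathcomp Require Export all_boot all_order all_algebra.
From mathcomp Require Export perm.
From mathcomp Require Export all_classical all_reals all_analysis.

Set Implicit Arguments.
Unset Strict Implicit.
Unset Printing Implicit Defensive.

Export Order.TTheory GRing.Theory Num.Theory.
Export numFieldNormedType.Exports.
Global Open Scope classical_set_scope.
Global Open Scope ring_scope.

(* A matrix with [bdim n d] rows is cut into n consecutive blocks of d rows by
   [submxcol], and assembled from blocks by [\mxblock] and [\mxcol]. *)
Notation bdim n d := (\sum_(i < n) d)%N.

Section Norms.
Variable R : realType.

Definition mxdot m p (X Y : 'M[R]_(m, p)) : R := \tr (X^T *m Y).

Definition frob m p (X : 'M[R]_(m, p)) : R := Num.sqrt (mxdot X X).

(* On column vectors [frob] is the Euclidean norm. *)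
Definition opnorm m p (A : 'M[R]_(m, p)) : R :=
  sup [set frob (A *m x) | x in [set x : 'cV[R]_p | frob x <= 1]].

End Norms.

Section Groups.
Variables (R : realType) (d : nat).
Implicit Types (G : set 'M[R]_d) (X Q : 'M[R]_d).

Definition orthogonal_group : set 'M[R]_d := [set Q | Q^T *m Q = 1%:M].

Definition closed_orthogonal_subgroup G : Prop :=
  [/\ G `<=` orthogonal_group,
      closed G,
      G 1%:M,
      forall Q1 Q2, G Q1 -> G Q2 -> G (Q1 *m Q2) &
      forall Q, G Q -> G (invmx Q)].

Definition convex_hull G : set 'M[R]_d :=
  [set X | exists (m : nat) (w : 'I_m -> R) (Q : 'I_m -> 'M[R]_d),
     [/\ forall k, 0 <= w k, \sum_(k < m) w k = 1,
         forall k, G (Q k) & X = \sum_(k < m) w k *: Q k]].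

Definition is_projection G X Q : Prop :=
  G Q /\ forall Q', G Q' -> frob (X - Q) <= frob (X - Q').

Definition left_coset G Q : set 'M[R]_d := [set Q *m Q' | Q' in G].

(* The infimum is attained when G is nonempty and compact; in particular for
   every closed subgroup of the orthogonal group. *)
Definition coset_dist G Q1 Q2 : R := inf [set frob (Q1 - Q2 *m Q') | Q' in G].

(* Distance from the coset of Q to a finite set of cosets; the infimum is a
   minimum as soon as the set is nonempty. *)
Definition coset_set_dist G (QQ : set (set 'M[R]_d)) Q : R :=
  inf [set coset_dist G Q1 Q | Q1 in [set Q1 | QQ (left_coset G Q1)]].

Definition orthogonal_cosets G : set (set 'M[R]_d) :=
  [set left_coset G Q | Q in orthogonal_group].

End Groups.

Section Synchronization.
Variables (R : realType) (n d : nat).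
Implicit Types (G : set 'M[R]_d) (Y Z : 'M[R]_(bdim n d, d)).

Definition in_blocks G Y : Prop := forall i : 'I_n, G (submxcol Y i).

(* Again a minimum when G is compact. *)
Definition est_error G (Gstar Y : 'M[R]_(bdim n d, d)) : R :=
  inf [set frob (Y - Gstar *m Q) | Q in G].

Definition observation_matrix (E : {set 'I_n * 'I_n})
    (Cobs : 'I_n -> 'I_n -> 'M[R]_d) : 'M[R]_(bdim n d) :=
  \mxblock_(i < n, j < n)
    (if (i, j) \in E then Cobs i j
     else if (j, i) \in E then (Cobs j i)^T
     else if i == j then 1%:M else 0).

(* The sequence [l] lists the eigenvalues of C with multiplicity, in
   nonincreasing order; the columns of V may come in any order. *)
Definition top_eigenvectors (C : 'M[R]_(bdim n d))
    (V : 'M[R]_(bdim n d, d)) : Prop :=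
  V^T *m V = 1%:M /\
  exists (l : seq R) (s : 'S_d),
    [/\ sorted >=%R l,
        char_poly C = \prod_(x <- l) ('X - x%:P) &
        forall j : 'I_d, C *m col j V = l`_(s j) *: col j V].

Definition block_projection G Y Z : Prop :=
  forall i : 'I_n, is_projection G (submxcol Y i) (submxcol Z i).

(* [P Q] is the value chosen for the blockwise projection of V Q onto G.  The
   choice is indexed by Q, not by the matrix V Q: where projections are not
   unique, an equivariant choice depending on the projected matrix only need
   not exist (the zero matrix is fixed by all of G), whereas one indexed by Q
   always does. *)
Definition compatible_block_projection G (V : 'M[R]_(bdim n d, d))
    (P : 'M[R]_d -> 'M[R]_(bdim n d, d)) : Prop :=
  (forall Q, orthogonal_group Q -> block_projection G (V *m Q) (P Q)) /\
  (forall Q Q', orthogonal_group Q -> G Q' -> P (Q *m Q') = P Q *m Q').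

Definition entropic_score (C : 'M[R]_(bdim n d))
    (P : 'M[R]_d -> 'M[R]_(bdim n d, d)) (Q : 'M[R]_d) : R :=
  mxdot (C *m P Q) (P Q).

Definition entropic_spectral_estimator G (C : 'M[R]_(bdim n d))
    (V : 'M[R]_(bdim n d, d)) (QQ : set (set 'M[R]_d))
    (Ghat : 'M[R]_(bdim n d, d)) : Prop :=
  exists (P : 'M[R]_d -> 'M[R]_(bdim n d, d)) (Qhat : 'M[R]_d),
    [/\ compatible_block_projection G V P,
        QQ (left_coset G Qhat),
        forall Q, QQ (left_coset G Q) ->
          entropic_score C P Q <= entropic_score C P Qhat &
        Ghat = P Qhat].

End Synchronization.

(* Main.v *)
Require Import Defs.
From mathcomp Require Import ring lra.

(* Some representative Q of a coset in the net is within eps of Qstar; since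
   projection onto G^n at most doubles distances to G^n, Z = P Q satisfies
   |Z - Gstar| <= 2 sqrt n eps + 4 sqrt (2 d) |D| / (eta sqrt n), where
   D = C - eta Gstar Gstar^T.  For Y in G^n let X = Gstar^T Y / n, a point of
   conv G.  The hypothesis on beta bounds beta |Y - Gstar Pi(X)|^2 by
   2 n (d - |X|^2), whereas n (d - |X|^2) <= |Y - Gstar|^2 always holds.
   Optimality of Y = Ghat against Z compares the two values of |X|^2 up to
   a term in D that is linear in the error e = |Ghat - Gstar Pi(X)|.  The
   result is a quadratic inequality for e, which yields the bound. *)

Set Implicit Arguments.
Unset Strict Implicit.
Unset Printing Implicit Defensive.

(** * Frobenius inner product, Frobenius norm and operator norm *)

Section FrobeniusTheory.
Variable R : realType.

Lemma mxdotE m p (X Y : 'M[R]_(m, p)) :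
  mxdot X Y = \sum_(j < p) \sum_(i < m) X i j * Y i j.
Proof.
rewrite /mxdot /mxtrace; apply: eq_bigr => j _; rewrite mxE.
by apply: eq_bigr => i _; rewrite mxE.
Qed.

Lemma mxdotC m p (X Y : 'M[R]_(m, p)) : mxdot X Y = mxdot Y X.
Proof. by rewrite /mxdot -mxtrace_tr trmx_mul trmxK. Qed.

Lemma mxdotDl m p (X Y Z : 'M[R]_(m, p)) :
  mxdot (X + Y) Z = mxdot X Z + mxdot Y Z.
Proof. by rewrite /mxdot linearD mulmxDl mxtraceD. Qed.

Lemma mxdotDr m p (X Y Z : 'M[R]_(m, p)) :
  mxdot Z (X + Y) = mxdot Z X + mxdot Z Y.
Proof. by rewrite mxdotC mxdotDl !(mxdotC Z). Qed.

Lemma mxdotZl m p a (X Y : 'M[R]_(m, p)) : mxdot (a *: X) Y = a * mxdot X Y.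
Proof. by rewrite /mxdot linearZ -scalemxAl mxtraceZ. Qed.

Lemma mxdotZr m p a (X Y : 'M[R]_(m, p)) : mxdot X (a *: Y) = a * mxdot X Y.
Proof. by rewrite mxdotC mxdotZl mxdotC. Qed.

Lemma mxdotNl m p (X Y : 'M[R]_(m, p)) : mxdot (- X) Y = - mxdot X Y.
Proof. by rewrite -scaleN1r mxdotZl mulN1r. Qed.

Lemma mxdotNr m p (X Y : 'M[R]_(m, p)) : mxdot X (- Y) = - mxdot X Y.
Proof. by rewrite mxdotC mxdotNl mxdotC. Qed.

Lemma mxdot_mull m p q (A : 'M[R]_(m, p)) (X : 'M[R]_(p, q)) Y :
  mxdot (A *m X) Y = mxdot X (A^T *m Y).
Proof. by rewrite /mxdot trmx_mul mulmxA. Qed.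

Lemma mxdot_mulr m p q (A : 'M[R]_(p, q)) (X : 'M[R]_(m, p)) Y :
  mxdot (X *m A) Y = mxdot X (Y *m A^T).
Proof. by rewrite /mxdot trmx_mul -mulmxA mxtrace_mulC mulmxA. Qed.

Lemma mxdot_ge0 m p (X : 'M[R]_(m, p)) : 0 <= mxdot X X.
Proof.
rewrite mxdotE sumr_ge0 // => j _.
by rewrite sumr_ge0 // => i _; rewrite -expr2 sqr_ge0.
Qed.

Lemma frob_ge0 m p (X : 'M[R]_(m, p)) : 0 <= frob X.
Proof. exact: sqrtr_ge0. Qed.

Lemma sqr_frob m p (X : 'M[R]_(m, p)) : frob X ^+ 2 = mxdot X X.
Proof. by rewrite sqr_sqrtr ?mxdot_ge0. Qed.

Lemma sqr_frobB m p (X Y : 'M[R]_(m, p)) :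
  frob (X - Y) ^+ 2 = mxdot X X - 2 * mxdot X Y + mxdot Y Y.
Proof.
rewrite sqr_frob mxdotDl !mxdotDr !mxdotNl !mxdotNr (mxdotC Y X).
by ring.
Qed.

Lemma frobZ m p a (X : 'M[R]_(m, p)) : frob (a *: X) = `|a| * frob X.
Proof.
by rewrite /frob mxdotZl mxdotZr mulrA -expr2 sqrtrM ?sqr_ge0 // sqrtr_sqr.
Qed.

Lemma frobN m p (X : 'M[R]_(m, p)) : frob (- X) = frob X.
Proof. by rewrite -scaleN1r frobZ normrN1 mul1r. Qed.

Lemma frobB m p (X Y : 'M[R]_(m, p)) : frob (X - Y) = frob (Y - X).
Proof. by rewrite -frobN opprB. Qed.

Lemma frob_eq0 m p (X : 'M[R]_(m, p)) : frob X = 0 -> X = 0.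
Proof.
move=> /(congr1 (fun x => x ^+ 2)); rewrite sqr_frob expr0n mxdotE /= => X0.
apply/matrixP => i j; rewrite mxE; apply/eqP; rewrite -sqrf_eq0 expr2.
have ge0 k : 0 <= \sum_i0 X i0 k * X i0 k.
  by rewrite sumr_ge0 // => ? _; rewrite -expr2 sqr_ge0.
move: X0 => /eqP; rewrite psumr_eq0 => [/allP/(_ j)|//].
rewrite mem_index_enum psumr_eq0 => [/(_ isT)/allP/(_ i)|? _].
  by rewrite mem_index_enum => /(_ isT).
by rewrite -expr2 sqr_ge0.
Qed.

(** Cauchy-Schwarz: for a = |X| and b = |Y|, the square |b X - a Y|^2 equals 2 a b (a b - <X, Y>),
    and a b can be divided out once it is positive. *)
Lemma mxdot_le m p (X Y : 'M[R]_(m, p)) : mxdot X Y <= frob X * frob Y.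
Proof.
have [X0|X0] := eqVneq (frob X) 0.
  by rewrite X0 (frob_eq0 X0) -(scale0r 0) mxdotZl !mul0r.
have [Y0|Y0] := eqVneq (frob Y) 0.
  by rewrite Y0 (frob_eq0 Y0) -(scale0r 0) mxdotZr mulr0 mul0r.
have XY_gt0 : 0 < frob X * frob Y by rewrite mulr_gt0 // lt0r frob_ge0 ?X0 ?Y0.
have := sqr_ge0 (frob (frob Y *: X - frob X *: Y)).
rewrite sqr_frobB !mxdotZl !mxdotZr -!sqr_frob => ge0.
rewrite -subr_ge0 -(pmulr_rge0 _ XY_gt0) -(pmulr_rge0 _ (ltr0Sn R 1)).
by apply: le_trans ge0 _; rewrite le_eqVlt; apply/orP; left; apply/eqP; ring.
Qed.

Lemma frobD m p (X Y : 'M[R]_(m, p)) : frob (X + Y) <= frob X + frob Y.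
Proof.
rewrite -(ler_pXn2r (ltn0Sn 1)) ?nnegrE ?addr_ge0 ?frob_ge0 //.
rewrite sqrrD -[X in X + Y]opprK addrC -[Y + _]/(Y - - X) sqr_frobB.
have := mxdot_le X Y; rewrite !sqr_frob !mxdotNl !mxdotNr (mxdotC Y X); lra.
Qed.

Lemma frob_isometry m p q (V : 'M[R]_(m, p)) (X : 'M[R]_(p, q)) :
  V^T *m V = 1%:M -> frob (V *m X) = frob X.
Proof. by move=> VV; rewrite /frob mxdot_mull mulmxA VV mul1mx. Qed.

Lemma sqr_frob_col m p (X : 'M[R]_(m, p)) :
  frob X ^+ 2 = \sum_j frob (col j X) ^+ 2.
Proof.
rewrite sqr_frob mxdotE; apply: eq_bigr => j _; rewrite sqr_frob mxdotE big_ord1.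
by apply: eq_bigr => i _; rewrite !mxE.
Qed.

Lemma frob_mulmx m p q (A : 'M[R]_(m, p)) (B : 'M[R]_(p, q)) :
  frob (A *m B) <= frob A * frob B.
Proof.
rewrite -(ler_pXn2r (ltn0Sn 1)) ?nnegrE ?mulr_ge0 ?frob_ge0 //.
rewrite exprMn (sqr_frob_col B) mulr_sumr sqr_frob mxdotE; apply: ler_sum => j _.
have -> : frob A ^+ 2 = frob A^T ^+ 2.
  by rewrite !sqr_frob /mxdot trmxK mxtrace_mulC.
rewrite sqr_frob_col mulr_suml; apply: ler_sum => i _.
rewrite -expr2 -exprMn.
have -> : (A *m B) i j = mxdot (col i A^T) (col j B).
  by rewrite mxdotE big_ord1 mxE; apply: eq_bigr => k _; rewrite !mxE.
rewrite -[leLHS]real_normK ?num_real //.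
rewrite lerXn2r ?nnegrE ?mulr_ge0 ?frob_ge0 // ler_norml mxdot_le andbT.
by rewrite lerNl -mxdotNl -(frobN (col i _)) mxdot_le.
Qed.

(** Makes the [sup] in [opnorm] a genuine least upper bound; the crude bound |A x| <= |A|_F |x|
    suffices. *)
Lemma opnorm_has_ubound m p (A : 'M[R]_(m, p)) :
  has_ubound [set frob (A *m x) | x in [set x : 'cV[R]_p | frob x <= 1]].
Proof.
exists (frob A) => _ [x /= x1 <-]; apply: le_trans (frob_mulmx _ _) _.
by rewrite ler_piMr ?frob_ge0.
Qed.

Lemma frob0 m p : frob (0 : 'M[R]_(m, p)) = 0.
Proof. by rewrite -(scale0r 0) frobZ normr0 mul0r. Qed.

Lemma opnorm_ge0 m p (A : 'M[R]_(m, p)) : 0 <= opnorm A.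
Proof.
apply: ub_le_sup; first exact: opnorm_has_ubound.
by exists 0; rewrite /= ?mulmx0 frob0.
Qed.

Lemma frob_mulmx_col m p (A : 'M[R]_(m, p)) (x : 'cV_p) :
  frob (A *m x) <= opnorm A * frob x.
Proof.
have [x0|x0] := eqVneq (frob x) 0.
  by rewrite x0 (frob_eq0 x0) mulmx0 frob0 mulr0.
have x_gt0 : 0 < frob x by rewrite lt0r x0 frob_ge0.
rewrite -ler_pdivrMr // mulrC; apply: ub_le_sup; first exact: opnorm_has_ubound.
have inv_ge0 : 0 <= (frob x)^-1 by rewrite invr_ge0 frob_ge0.
exists ((frob x)^-1 *: x) => /=; first by rewrite frobZ ger0_norm // mulVf.
by rewrite -scalemxAr frobZ ger0_norm.
Qed.

Lemma frob_mulmx_opnorm m p q (A : 'M[R]_(m, p)) (B : 'M[R]_(p, q)) :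
  frob (A *m B) <= opnorm A * frob B.
Proof.
rewrite -(ler_pXn2r (ltn0Sn 1)) ?nnegrE ?mulr_ge0 ?opnorm_ge0 ?frob_ge0 //.
rewrite exprMn !sqr_frob_col mulr_sumr; apply: ler_sum => j _.
rewrite -exprMn lerXn2r ?nnegrE ?mulr_ge0 ?opnorm_ge0 ?frob_ge0 //.
by rewrite colE -mulmxA -colE frob_mulmx_col.
Qed.

Lemma mxdot_quadB m p (D : 'M[R]_m) (A B : 'M[R]_(m, p)) : D^T = D ->
  mxdot (D *m A) A - mxdot (D *m B) B = mxdot (D *m (A - B)) (A + B).
Proof.
move=> DT; rewrite mulmxBr mxdotDl mxdotNl !mxdotDr.
have -> : mxdot (D *m B) A = mxdot (D *m A) B by rewrite mxdot_mull DT mxdotC.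
by ring.
Qed.

(** By symmetry the difference factors as <D (A - B), A + B>. Being linear in |A - B|, the bound
    keeps the noise term of the error inequality linear in the error. *)
Lemma mxdot_quadB_le m p (D : 'M[R]_m) (A B : 'M[R]_(m, p)) : D^T = D ->
  mxdot (D *m A) A - mxdot (D *m B) B
    <= opnorm D * frob (A - B) * (frob A + frob B).
Proof.
move=> DT; rewrite mxdot_quadB //; apply: le_trans (mxdot_le _ _) _.
by apply: ler_pM; rewrite ?frob_ge0 ?frob_mulmx_opnorm ?frobD.
Qed.

End FrobeniusTheory.

(** * Closed subgroups of the orthogonal group, cosets and projections *)

Section OrthogonalSubgroups.
Variables (R : realType) (d : nat) (G : set 'M[R]_d).
Hypothesis cG : closed_orthogonal_subgroup G.

Lemma orthogonal_invmx (Q : 'M[R]_d) : orthogonal_group Q -> invmx Q = Q^T.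
Proof.
move=> QQ; have uQ : Q \in unitmx by apply: (mulmx1_unit QQ).2.
by rewrite -[LHS]mul1mx -QQ mulmxK.
Qed.

Lemma orthogonal_mulmxT (Q : 'M[R]_d) : orthogonal_group Q -> Q *m Q^T = 1%:M.
Proof. exact: mulmx1C. Qed.

Lemma frob_mulmx_orthogonal m (X : 'M[R]_(m, d)) (Q : 'M[R]_d) :
  orthogonal_group Q -> frob (X *m Q) = frob X.
Proof.
move=> oQ; rewrite /frob mxdot_mulr -mulmxA orthogonal_mulmxT //.
by rewrite mulmx1.
Qed.

Lemma subgroup_orthogonal Q : G Q -> orthogonal_group Q.
Proof. by case: cG => + _ _ _ _; apply. Qed.

Lemma subgroup_trmx Q : G Q -> G Q^T.
Proof.
move=> GQ; rewrite -orthogonal_invmx; last exact: subgroup_orthogonal.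
by case: cG => _ _ _ _; apply.
Qed.

Lemma subgroup_mulmx Q Q' : G Q -> G Q' -> G (Q *m Q').
Proof. by case: cG => _ _ _ + _; apply. Qed.

Lemma orthogonal_mulmx (Q Q' : 'M[R]_d) :
  orthogonal_group Q -> orthogonal_group Q' -> orthogonal_group (Q *m Q').
Proof.
by rewrite /orthogonal_group /= => oQ oQ'; rewrite trmx_mul mulmxA
  -(mulmxA _ _ Q) oQ mulmx1.
Qed.

Lemma left_coset_refl Q : left_coset G Q Q.
Proof. by exists 1%:M; rewrite ?mulmx1 //; case: cG. Qed.

Lemma left_coset_mulmx Q Q' : G Q' -> left_coset G (Q *m Q') = left_coset G Q.
Proof.
move=> GQ'; apply/seteqP; split => _ [Q'' GQ'' <-].
  by exists (Q' *m Q''); rewrite ?mulmxA //; exact: subgroup_mulmx.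
exists (Q'^T *m Q''); first exact/subgroup_mulmx/GQ''/subgroup_trmx.
rewrite -mulmxA (mulmxA Q') orthogonal_mulmxT ?mul1mx //.
exact: subgroup_orthogonal.
Qed.

Lemma orthogonal_cosetsP Q :
  orthogonal_cosets G (left_coset G Q) -> orthogonal_group Q.
Proof.
case=> Q1 oQ1 eQ; have := left_coset_refl Q; rewrite -eQ => -[Q' GQ' <-].
exact/(orthogonal_mulmx oQ1)/subgroup_orthogonal.
Qed.

(** A strict bound on the two nested infima yields actual elements without showing that they are
    attained; [Q0] witnesses nonemptiness. *)
Lemma coset_set_dist_lt (QQ : set (set 'M[R]_d)) (Q0 Q1 : 'M[R]_d) eps :
  QQ (left_coset G Q0) -> coset_set_dist G QQ Q1 < eps ->
  exists2 Q, QQ (left_coset G Q) & frob (Q - Q1) < eps.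
Proof.
move=> QQ0 /inf_lt[|_ [Q /= QQQ <-]].
  by exists (coset_dist G Q0 Q1), Q0.
case/inf_lt => [|_ [Q' GQ' <-] lt_eps].
  by exists (frob (Q - Q1 *m 1%:M)), 1%:M => //; case: cG.
(* The factor [Q'] moves to the other side: it stays within the coset and right multiplication by it
   is an isometry. *)
exists (Q *m Q'^T); first by rewrite left_coset_mulmx //; exact: subgroup_trmx.
have oQ' := subgroup_orthogonal GQ'.
rewrite -(frob_mulmx_orthogonal _ oQ') mulmxBl -mulmxA oQ' mulmx1.
exact: lt_eps.
Qed.

Lemma mxdot_orthogonal (Q : 'M[R]_d) : orthogonal_group Q -> mxdot Q Q = d%:R.
Proof. by rewrite /mxdot => ->; rewrite mxtrace1. Qed.

(** Elements of [G] all have squared norm d, so comparing squared distances to [X] amounts to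
    comparing inner products with [X]. *)
Lemma is_projection_mxdot X Q Q' :
  is_projection G X Q -> G Q' -> mxdot X Q' <= mxdot X Q.
Proof.
move=> [GQ min] GQ'; have := min _ GQ'.
rewrite -(ler_pXn2r (ltn0Sn 1)) ?nnegrE ?frob_ge0 // !sqr_frobB.
rewrite (mxdot_orthogonal (subgroup_orthogonal GQ)).
rewrite (mxdot_orthogonal (subgroup_orthogonal GQ')); lra.
Qed.

End OrthogonalSubgroups.

(** * Blockwise projection, symmetry of the data matrix and block means *)

Section Blocks.
Variables (R : realType) (n d : nat) (G : set 'M[R]_d).
Hypothesis cG : closed_orthogonal_subgroup G.
Implicit Types Y Z : 'M[R]_(bdim n d, d).

Lemma trmx_mul_submxcol Y Z :
  Y^T *m Z = \sum_i (submxcol Y i)^T *m submxcol Z i.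
Proof.
by rewrite -[in LHS](submxcolK Y) -[in LHS](submxcolK Z) tr_mxcol mul_mxrow_mxcol.
Qed.

Lemma mxdot_submxcol Y Z :
  mxdot Y Z = \sum_i mxdot (submxcol Y i) (submxcol Z i).
Proof. by rewrite /mxdot trmx_mul_submxcol raddf_sum. Qed.

Lemma mxdot_in_blocks Y : in_blocks G Y -> mxdot Y Y = n%:R * d%:R.
Proof.
move=> GY; rewrite mxdot_submxcol.
under eq_bigr do rewrite (mxdot_orthogonal (subgroup_orthogonal cG (GY _))).
by rewrite sumr_const card_ord mulr_natl.
Qed.

Lemma frob_in_blocks Y : in_blocks G Y -> frob Y = Num.sqrt (n%:R * d%:R).
Proof. by move=> GY; rewrite /frob mxdot_in_blocks. Qed.

Lemma in_blocks_mulmx Y Q : in_blocks G Y -> G Q -> in_blocks G (Y *m Q).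
Proof.
by move=> GY GQ i; rewrite -submxcol_mul; apply: subgroup_mulmx.
Qed.

Lemma block_projection_in_blocks Y Z : block_projection G Y Z -> in_blocks G Z.
Proof. by move=> pZ i; case: (pZ i). Qed.

(* All elements of G have the same norm, so projecting onto G^n maximizes the
   inner product and is insensitive to the scaling by s. *)
Lemma block_projection_scale Y Z Z' s : 0 <= s ->
  block_projection G Y Z -> in_blocks G Z' ->
  frob (s *: Y - Z) <= frob (s *: Y - Z').
Proof.
move=> s_ge0 pZ GZ'; rewrite -(ler_pXn2r (ltn0Sn 1)) ?nnegrE ?frob_ge0 //.
rewrite !sqr_frobB !mxdotZl (mxdot_in_blocks GZ').
rewrite (mxdot_in_blocks (block_projection_in_blocks pZ)).
have : mxdot Y Z' <= mxdot Y Z.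
  rewrite !mxdot_submxcol; apply: ler_sum => i _.
  exact: (is_projection_mxdot cG (pZ i)).
by move=> /(ler_wpM2l s_ge0); lra.
Qed.

(** Triangle inequality through [s *: Y], to which [Z] is at least as close as [Z']. *)
Lemma block_projection_near Y Z Z' s : 0 <= s ->
  block_projection G Y Z -> in_blocks G Z' ->
  frob (Z - Z') <= 2 * frob (s *: Y - Z').
Proof.
move=> s_ge0 pZ GZ'; rewrite -(subrKA (s *: Y)) mulr2n mulrDl !mul1r.
apply: le_trans (frobD _ _) _; rewrite lerD2r frobB.
exact: block_projection_scale.
Qed.

Lemma observation_matrix_sym (E : {set 'I_n * 'I_n})
    (Cobs : 'I_n -> 'I_n -> 'M[R]_d) :
  (forall i j, (i, j) \in E -> (i < j)%N) ->
  (observation_matrix E Cobs)^T = observation_matrix E Cobs.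
Proof.
move=> ltE; rewrite /observation_matrix tr_mxblock; apply: eq_mxblock => i j.
case: ifPn => [/ltE ltji|_].
  (* Since pairs in [E] are increasing, (i, j) and (j, i) are never both in [E], so the order of the
     tests is harmless. *)
  case: ifPn => [/ltE/(ltn_trans ltji)|_]; first by rewrite ltnn.
  by [].
case: ifPn => [_|_]; first by rewrite trmxK.
by rewrite eq_sym; case: ifP => _; rewrite ?trmx1 ?trmx0.
Qed.

(** The matrix is the average, with uniform weights, of the products of corresponding blocks, each
    of which lies in the group [G]. *)
Lemma convex_hull_block_mean Y Z : (0 < n)%N ->
  in_blocks G Y -> in_blocks G Z -> convex_hull G (n%:R^-1 *: (Y^T *m Z)).
Proof.
move=> n_gt0 GY GZ; exists n, (fun=> n%:R^-1),
  (fun i => (submxcol Y i)^T *m submxcol Z i).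
split => [_||i|]; first by rewrite invr_ge0.
- by rewrite sumr_const card_ord -[_ *+ n]mulr_natr mulVf // pnatr_eq0 -lt0n.
- by apply: (subgroup_mulmx cG); [apply: (subgroup_trmx cG)|].
- by rewrite trmx_mul_submxcol scaler_sumr.
Qed.

End Blocks.

(** * The quadratic inequality for the error and its solution *)

Section ErrorRecursion.
Variables (R : realType) (n d : nat) (G : set 'M[R]_d) (Pi : 'M[R]_d -> 'M[R]_d).
Variables (beta eta : R).
Hypotheses (n_gt0 : (0 < n)%N) (eta_gt0 : 0 < eta).
Hypothesis cG : closed_orthogonal_subgroup G.
Hypothesis PiP : forall X, is_projection G X (Pi X).
Hypothesis betaP : forall X, convex_hull G X ->
  beta * \tr (1%:M - X^T *m Pi X) <= d%:R - frob X ^+ 2.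
Implicit Types Y Z : 'M[R]_(bdim n d, d).

Let n_neq0 : n%:R != 0 :> R. Proof. by rewrite pnatr_eq0 -lt0n. Qed.

Lemma sqr_frobB_in_blocks Y Z : in_blocks G Y -> in_blocks G Z ->
  frob (Y - Z) ^+ 2 = 2 * (n%:R * d%:R - mxdot Y Z).
Proof.
by move=> GY GZ; rewrite sqr_frobB !(mxdot_in_blocks cG) //; ring.
Qed.

(** With X the block mean, |X - I|^2 >= 0 gives d - |X|^2 <= 2 (d - tr X), and n tr X = <Y, Z>. *)
Lemma sqr_frob_block_mean_ge Y Z : in_blocks G Y -> in_blocks G Z ->
  n%:R * (d%:R - frob (n%:R^-1 *: (Y^T *m Z)) ^+ 2) <= frob (Z - Y) ^+ 2.
Proof.
move=> GY GZ; set X := _ *: _; rewrite sqr_frobB_in_blocks //.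
have := sqr_ge0 (frob (X - 1%:M)).
rewrite sqr_frobB -sqr_frob {2}/X mxdotZl mxdot_mull trmxK mulmx1.
rewrite /(mxdot 1%:M _) trmx1 mulmx1 mxtrace1.
have n0 : 0 < n%:R :> R by rewrite ltr0n.
move=> /(mulr_ge0 (ltW n0)).
rewrite mulrDr mulrBr (mulrCA _ 2) mulVKf //; lra.
Qed.

(** The squared distance equals 2 n tr(I - X^T Pi(X)), to which the hypothesis on [beta] applies
    because X lies in conv G. *)
Lemma sqr_frob_block_mean_le Y Z (X := n%:R^-1 *: (Y^T *m Z)) :
  in_blocks G Y -> in_blocks G Z ->
  beta * frob (Z - Y *m Pi X) ^+ 2 <= 2 * n%:R * (d%:R - frob X ^+ 2).
Proof.
move=> GY GZ; have GPi := (PiP X).1.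
rewrite sqr_frobB_in_blocks //; last exact: in_blocks_mulmx.
have n0 : 0 < n%:R :> R by rewrite ltr0n.
have := betaP (convex_hull_block_mean cG n_gt0 GY GZ).
rewrite -/X -(ler_pM2l n0) [\tr _]raddfB /= mxtrace1.
have -> : mxdot Z (Y *m Pi X) = n%:R * \tr (X^T *m Pi X).
  rewrite -/(mxdot X _) mxdotZl mulVKf // mxdot_mull trmxK //.
lra.
Qed.

Lemma error_recursion (C : 'M[R]_(bdim n d)) Gstar Y Z
    (Q := Pi (n%:R^-1 *: (Gstar^T *m Y))) :
  C^T = C -> in_blocks G Gstar -> in_blocks G Y -> in_blocks G Z ->
  mxdot (C *m Z) Z <= mxdot (C *m Y) Y ->
  beta * frob (Y - Gstar *m Q) ^+ 2 <= 2 * frob (Z - Gstar) ^+ 2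
    + 4 * (Num.sqrt d%:R * opnorm (C - eta *: (Gstar *m Gstar^T))
             / (eta * Num.sqrt n%:R))
      * (frob (Y - Gstar *m Q) + frob (Z - Gstar)).
Proof.
move=> CT GGs GY GZ scoreYZ; set D := C - _; set e := frob (Y - _).
set f := frob (Z - _); set c := _ / _.
have [r r_gt0 r2] : exists2 r : R, 0 < r & r ^+ 2 = n%:R /\ r = Num.sqrt n%:R.
  exists (Num.sqrt n%:R); first by rewrite sqrtr_gt0 ltr0n.
  by rewrite sqr_sqrtr.
case: r2 => r2 rE.
have GQ : G Q := (PiP _).1.
have oQ := subgroup_orthogonal cG GQ.
have DT : D^T = D.
  by rewrite /D linearB linearZ /= trmx_mul trmxK CT.
(* The score splits into a noise part and a signal part; the signal part is a multiple of the
   squared norm of the block mean of W with [Gstar]. *)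
have quadE W : mxdot (C *m W) W
    = mxdot (D *m W) W + eta * n%:R ^+ 2 * frob (n%:R^-1 *: (Gstar^T *m W)) ^+ 2.
  rewrite /D mulmxBl mxdotDl mxdotNl -scalemxAl mxdotZl -mulmxA.
  rewrite [mxdot (Gstar *m _) _]mxdot_mull.
  rewrite frobZ exprMn real_normK ?num_real // sqr_frob exprVn mulrA mulfK ?subrK //.
  by rewrite sqrf_eq0.
(* The noise part is unchanged by right rotation, so [Y] may be replaced by the aligned [Y *m Q^T],
   which is within e + f of [Z]. *)
have quad_orth : mxdot (D *m (Y *m Q^T)) (Y *m Q^T) = mxdot (D *m Y) Y.
  by rewrite mulmxA mxdot_mulr trmxK -mulmxA oQ mulmx1.
have GYQ : in_blocks G (Y *m Q^T).
  by apply: (in_blocks_mulmx cG) => //; apply: (subgroup_trmx cG).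
have dist_le : frob (Y *m Q^T - Z) <= e + f.
  rewrite -(subrKA Gstar); apply: le_trans (frobD _ _) _.
  rewrite (frobB Gstar) lerD2r -(frob_mulmx_orthogonal _ oQ) mulmxBl -mulmxA.
  by rewrite oQ mulmx1.
have := mxdot_quadB_le (Y *m Q^T) Z DT.
rewrite quad_orth (frob_in_blocks cG GYQ) (frob_in_blocks cG GZ) sqrtrM ?ler0n // -rE => quad_le.
have {}quad_le : mxdot (D *m Y) Y - mxdot (D *m Z) Z
    <= 2 * eta * n%:R * c * (e + f).
  apply: le_trans quad_le _; rewrite -mulrA.
  (* Both [Y *m Q^T] and [Z] have norm sqrt(n d); their sum produces the factor 2. *)
  have -> : 2 * eta * n%:R * c * (e + f)
      = opnorm D * ((e + f) * (r * Num.sqrt d%:R + r * Num.sqrt d%:R)).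
    rewrite /c -rE -r2; field.
    by rewrite !gt_eqF.
  rewrite ler_wpM2l ?opnorm_ge0 // ler_wpM2r //.
  by rewrite addr_ge0 // mulr_ge0 ?sqrtr_ge0 // ltW.
have meanY := sqr_frob_block_mean_le GGs GY.
have meanZ := sqr_frob_block_mean_ge GGs GZ.
move: scoreYZ meanY meanZ; rewrite !quadE -/Q -/e -/f.
set a := frob (_ *: (_ *m Y)) ^+ 2; set b := frob (_ *: (_ *m Z)) ^+ 2.
move=> scoreYZ meanY meanZ.
have n0 : 0 < n%:R :> R by rewrite ltr0n.
have {}quad_le : eta * n%:R * (n%:R * (b - a)) <= eta * n%:R * (2 * c * (e + f)).
  have -> : eta * n%:R * (n%:R * (b - a))
      = eta * n%:R ^+ 2 * b - eta * n%:R ^+ 2 * a by ring.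
  have -> : eta * n%:R * (2 * c * (e + f)) = 2 * eta * n%:R * c * (e + f) by ring.
  lra.
move: quad_le; rewrite ler_pM2l ?mulr_gt0 // => quad_le.
(* Combines beta e^2 <= 2 n (d - a), n (d - b) <= f^2 and n (b - a) <= 2 c (e + f). *)
lra.
Qed.

End ErrorRecursion.

(** Applied with k = beta^(-1/2), s = sqrt 2 and u = 2 sqrt n eps'. The map x -> x (x - 4 k^2 c)
    increases on x >= 4 k^2 c. At the claimed bound t >= 12 k^2 c it already dominates the
    right-hand side with f replaced by its upper bound F, so e > t is impossible. *)
Lemma quadratic_recursion_bound (R : realType) (k s u c e f : R) :
  1 <= k -> 0 <= s -> s ^+ 2 = 2 -> 0 <= u -> 0 <= c -> 0 <= f ->
  f <= u + 4 * s * c ->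
  e ^+ 2 <= k ^+ 2 * (2 * f ^+ 2 + 4 * c * (e + f)) ->
  e <= s * k * u + 12 * k ^+ 2 * c.
Proof.
move=> k1 s0 s2 u0 c0 f0 fle ele; rewrite leNgt; apply/negP => te.
set t := s * k * u + _ in te.
have k0 : 0 <= k by lra.
have ku0 : 0 <= k * u by rewrite mulr_ge0.
have kc0 : 0 <= k ^+ 2 * c by rewrite mulr_ge0 ?sqr_ge0.
have sku0 : 0 <= s * k * u by rewrite !mulr_ge0.
have s1 : 1 <= s by nra.
have s2le : s <= 2 by nra.
pose F := u + 4 * s * c.
have tF : k ^+ 2 * (2 * F ^+ 2 + 4 * c * F) <= t * (t - 4 * k ^+ 2 * c).
  rewrite -subr_ge0.
  have -> : t * (t - 4 * k ^+ 2 * c) - k ^+ 2 * (2 * F ^+ 2 + 4 * c * F)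
     = (s ^+ 2 - 2) * (k ^+ 2 * u ^+ 2 - 32 * k ^+ 2 * c ^+ 2)
       + k ^+ 2 * (u * c * (20 * s * k - 16 * s - 4)
                  + c ^+ 2 * (96 * k ^+ 2 - 64 - 16 * s)).
    by rewrite /t /F; ring.
  (* The first term vanishes as s^2 = 2. The other coefficients are nonnegative for k >= 1 and 1 <=
     s <= 2; in particular 96 - 64 - 32 = 0, where 96 = 12 * 8 comes from the constant 12. *)
  rewrite s2 subrr mul0r add0r mulr_ge0 ?sqr_ge0 // addr_ge0 ?mulr_ge0 ?sqr_ge0 //.
    by nra.
  by nra.
have fF : k ^+ 2 * (2 * f ^+ 2 + 4 * c * f) <= k ^+ 2 * (2 * F ^+ 2 + 4 * c * F).
  rewrite ler_wpM2l ?sqr_ge0 // lerD //.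
    by rewrite ler_wpM2l // lerXn2r // nnegrE (le_trans f0).
  by rewrite ler_wpM2l // mulr_ge0.
have te2 : t * (t - 4 * k ^+ 2 * c) < e * (e - 4 * k ^+ 2 * c).
  have t_ge : 12 * k ^+ 2 * c <= t by rewrite lerDr.
  by rewrite ltr_pM //; lra.
nra.
Qed.

(** * Assembly of the error bound *)

Theorem theorem6 (R : realType) (n d : nat)
  (G : set 'M[R]_d) (Pi : 'M[R]_d -> 'M[R]_d) (beta eta eps : R)
  (Gstar : 'M[R]_(bdim n d, d))
  (E : {set 'I_n * 'I_n}) (Cobs : 'I_n -> 'I_n -> 'M[R]_d)
  (C : 'M[R]_(bdim n d)) (V : 'M[R]_(bdim n d, d)) (Qstar : 'M[R]_d)
  (QQ : set (set 'M[R]_d)) (Ghat : 'M[R]_(bdim n d, d)) :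
  (0 < n)%N -> (0 < d)%N ->
  closed_orthogonal_subgroup G ->
  (forall X, is_projection G X (Pi X)) ->
  0 < beta <= 1 ->
  (forall X, convex_hull G X ->
     beta * \tr (1%:M - X^T *m Pi X) <= d%:R - frob X ^+ 2) ->
  0 < eta -> 0 <= eps ->
  in_blocks G Gstar ->
  (forall i j, (i, j) \in E -> (i < j)%N) ->
  C = observation_matrix E Cobs ->
  top_eigenvectors C V ->
  orthogonal_group Qstar ->
  frob (V *m Qstar - (Num.sqrt n%:R)^-1 *: Gstar)
    <= 2 * Num.sqrt (2 * d%:R) * opnorm (C - eta *: (Gstar *m Gstar^T))
         / (eta * n%:R) ->
  finite_set QQ -> QQ `<=` orthogonal_cosets G ->
  coset_set_dist G QQ Qstar <= eps ->
  entropic_spectral_estimator G C V QQ Ghat ->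
  est_error G Gstar Ghat
    <= 2 * Num.sqrt (2 * n%:R / beta) * eps
       + 12 * Num.sqrt d%:R / (beta * eta * Num.sqrt n%:R)
         * opnorm (C - eta *: (Gstar *m Gstar^T)).

Proof.
move=> n_gt0 d_gt0 cG PiP /andP[beta_gt0 beta_le1] betaP eta_gt0 eps_ge0 GGs ltE.
move=> CE [VV _] oQs Vclose _ sQQ dist_le [P [Qhat [[Pproj _] QQhat Qhat_max ->]]].
set Delta := opnorm _ in Vclose *.
have oQQ Q : QQ (left_coset G Q) -> orthogonal_group Q.
  by move=> /sQQ; apply: orthogonal_cosetsP.
have CT : C^T = C by rewrite CE observation_matrix_sym.
have GP Q : orthogonal_group Q -> in_blocks G (P Q).
  by move=> /Pproj; exact: block_projection_in_blocks.
(* The projected block mean is the competitor in [G] that bounds the infimum defining the error. *)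
pose Q0 := Pi (n%:R^-1 *: (Gstar^T *m P Qhat)).
pose e := frob (P Qhat - Gstar *m Q0).
have est_le : est_error G Gstar (P Qhat) <= e.
  apply: ge_inf; first by exists 0 => _ [Q _ <-]; exact: frob_ge0.
  by exists Q0 => //; exact: (PiP _).1.
have Delta_ge0 : 0 <= Delta := opnorm_ge0 _.
pose r : R := Num.sqrt n%:R; pose q : R := Num.sqrt d%:R.
pose s : R := Num.sqrt 2; pose k : R := (Num.sqrt beta)^-1.
have r_gt0 : 0 < r by rewrite sqrtr_gt0 ltr0n.
have r2 : r ^+ 2 = n%:R by rewrite sqr_sqrtr.
have k2 : k ^+ 2 = beta^-1 by rewrite exprVn sqr_sqrtr // ltW.
have k_ge1 : 1 <= k.
  by rewrite invf_ge1 ?sqrtr_gt0 // -(sqrtr1 R) ler_wsqrtr.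
pose c := q * Delta / (eta * r).
have c_ge0 : 0 <= c.
  by rewrite divr_ge0 ?mulr_ge0 ?sqrtr_ge0 // ltW.
have sqrtE : Num.sqrt (2 * n%:R / beta) = s * r * k.
  by rewrite sqrtrM ?mulr_ge0 ?ler0n // sqrtrM ?ler0n // sqrtrV // ltW.
(* The slack eps' > eps gives the strict inequality needed to extract a representative; it is
   removed at the end. *)
have bound eps' : eps < eps' -> e <= s * k * (2 * r * eps') + 12 * k ^+ 2 * c.
  move=> lt_eps.
  have [Q QQQ Q_close] := coset_set_dist_lt cG QQhat (le_lt_trans dist_le lt_eps).
  have oQ := oQQ _ QQQ.
  have eps'_ge0 : 0 <= eps' by rewrite ltW // (le_lt_trans eps_ge0).
  have rec := error_recursion n_gt0 eta_gt0 cG PiP betaP CT GGs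
    (GP _ (oQQ _ QQhat)) (GP _ oQ) (Qhat_max _ QQQ).
  apply: (@quadratic_recursion_bound _ _ _ _ _ _ (frob (P Q - Gstar))) => //.
  - exact: sqrtr_ge0.
  - by rewrite sqr_sqrtr.
  - by rewrite !mulr_ge0 // ltW.
  - exact: frob_ge0.
  - have := block_projection_near cG (ltW r_gt0) (Pproj _ oQ) GGs.
    move=> /le_trans; apply.
    (* The first summand has norm |Q - Qstar| since [V] is an isometry; the second is the
       eigenvector perturbation. Multiplying by 2 r yields 2 r eps' + 4 s c. *)
    have -> : r *: (V *m Q) - Gstar
        = r *: (V *m (Q - Qstar) + (V *m Qstar - r^-1 *: Gstar)).
      by rewrite mulmxBr subrKA scalerBr scalerA divff ?scale1r // gt_eqF.
    rewrite frobZ gtr0_norm //.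
    have := frobD (V *m (Q - Qstar)) (V *m Qstar - r^-1 *: Gstar).
    rewrite (frob_isometry _ VV) => /le_trans/(_ (lerD (ltW Q_close) Vclose)).
    move=> /(ler_wpM2l (ltW r_gt0))/(ler_wpM2l (ler0n R 2))/le_trans; apply.
    rewrite sqrtrM ?ler0n // -/s -/q -r2 le_eqVlt; apply/orP; left; apply/eqP.
    by rewrite /c; field; rewrite !gt_eqF.
  - by rewrite k2 -(ler_pM2l beta_gt0) mulVKf ?gt_eqF.
apply: le_trans est_le _.
have -> : 12 * Num.sqrt d%:R / (beta * eta * Num.sqrt n%:R) * Delta
    = 12 * k ^+ 2 * c.
  by rewrite k2 /c -/q -/r; field; rewrite !gt_eqF.
rewrite sqrtE; apply/ler_addgt0Pr => del del_gt0.
have A_ge0 : 0 <= 2 * (s * r * k).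
  by rewrite !mulr_ge0 ?sqrtr_ge0 // invr_ge0 sqrtr_ge0.
set A := 2 * _ in A_ge0 *.
have A1_gt0 : 0 < A + 1 by rewrite ltr_wpDl.
(* This slack is scaled by A in the bound, hence costs at most [del]. *)
have /bound : eps < eps + del / (A + 1) by rewrite ltrDl divr_gt0.
move=> /le_trans; apply.
have -> : s * k * (2 * r * (eps + del / (A + 1))) = A * eps + A * (del / (A + 1)).
  by rewrite /A; ring.
have : A * (del / (A + 1)) <= del.
  by rewrite mulrA ler_pdivrMr // mulrC ler_wpM2l ?ltW // ltrDl.
lra.
Qed.
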